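(* Let $\mathbb{K}$ be a field of characteristic $0$. For every $d\geq3$ there exist quadratic $2$-step nilpotent Lie algebras of type $d$ over $\mathbb{K}$. Moreover, up to isometric isomorphism, the quadratic $2$-step nilpotent Lie algebras of type $d$ are of the form $$(\mathfrak{n}(A_1,\dots,A_{d_1})\oplus\mathfrak{a},\ \varphi_0\perp\phi),$$ where $d=d_1+d_2$, $d_1\geq3$, $d_1\neq4$, $\{A_1,\dots,A_{d_1}\}$ is a $d_1$-quadratic family of matrices over $\mathbb{K}$ with attached quadratic Lie algebra $(\mathfrak{n}(A_1,\dots,A_{d_1}),\varphi_0)$, and $(\mathfrak{a},\phi)$ is a quadratic abelian Lie algebra of dimension $d_2\geq0$.
   Context: All vector spaces are finite-dimensional over a field $\mathbb{K}$ of characteristic $0$. A pair $(\mathfrak{g},\varphi)$ with $\mathfrak{g}$ a Lie algebra is quadratic if $\varphi$ is a symmetric nondegenerate bilinear form on $\mathfrak{g}$ that is invariant: $\varphi([x,y],z)+\varphi(y,[x,z])=0$ for all $x,y,z\in\mathfrak{g}$. Let $\mathfrak{g}^2=[\mathfrak{g},\mathfrak{g}]$ and $\mathfrak{g}^3=[\mathfrak{g}^2,\mathfrak{g}]$ (linear spans). $\mathfrak{g}$ is $2$-step nilpotent if $\mathfrak{g}^3=0$ and $\mathfrak{g}^2\neq 0$; its type is $\dim\mathfrak{g}-\dim\mathfrak{g}^2$. A quadratic abelian Lie algebra is thus a vector space with zero bracket and a nondegenerate symmetric bilinear form. In a direct sum, $\oplus$ denotes the direct sum of Lie algebras (both summands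 are ideals) and $\perp$ the orthogonal sum of forms. Two quadratic Lie algebras $(\mathfrak{g},\varphi)$ and $(\mathfrak{g}',\varphi')$ are isometrically isomorphic if there is a Lie algebra isomorphism $f\colon\mathfrak{g}\to\mathfrak{g}'$ with $\varphi'(f(x),f(y))=\varphi(x,y)$ for all $x,y\in\mathfrak{g}$. $m$-quadratic family: for $m\geq2$, an indexed family $\{A_1,\dots,A_m\}$ of $m\times m$ matrices over $\mathbb{K}$ is $m$-quadratic if: (1) every $A_i$ is skewsymmetric ($A_i^t=-A_i$); (2) the $i$-th column of $A_i$ is zero, for every $i$; (3) for all $j>i$, the $j$-th column of $A_i$ is the additive inverse of the $i$-th column of $A_j$; (4) if $B_{i<j}$ denotes the submatrix of $A_i$ formed by its columns $i+1,\dots,m$ (in order), then the $m\times\frac{m(m-1)}{2}$ matrix $B(A_1,\dots,A_m)=[B_{1<j}\,B_{2<j}\,\dots\,B_{m-1<j}]$ has rank $m$. Attached quadratic Lie algebra: given an $m$-quadratic family $\{A_i=(a^i_{kj})\}$ ($a^i_{kj}$ the entry in row $k$, column $j$), $\mathfrak{n}(A_1,\dots,A_m)$ is the Lie algebra over $\mathbb{K}$ with basis $v_1,\dots,v_m,z_1,\dots,z_m$ and bracket $[v_i,v_j]=\sum_{k=1}^m a^i_{kj}z_k$, with all $z_i$ central. It carries the invariant nondegenerate symmetric bilinear form $\varphi_0$ determined by $\varphi_0(v_i,z_j)=\delta_{ij}$ and $\varphi_0(v_i,v_j)=\varphi_0(z_i,z_j)=0$. *)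

(* Defs.v *)
From HB Require Import structures.
From mathcomp Require Import all_boot all_order all_algebra.
Set Implicit Arguments.
Unset Strict Implicit.
Unset Printing Implicit Defensive.
Import GRing.Theory.
Local Open Scope ring_scope.

Record lieAlgebra (K : fieldType) := LieAlgebra {
  lie_space :> vectType K;
  lie_bracket : {bilinear lie_space -> lie_space -> lie_space};
  lie_bracket_alt : forall x, lie_bracket x x = 0;
  lie_jacobi : forall x y z,
    lie_bracket x (lie_bracket y z) + lie_bracket y (lie_bracket z x)
      + lie_bracket z (lie_bracket x y) = 0 }.

Notation "[ 'lie' x , y ]" := (lie_bracket _ x y)
  (at level 0, x, y at level 99, format "[ 'lie'  x ,  y ]") : ring_scope.

Record quadraticLie (K : fieldType) := QuadraticLie {
  quad_lie :> lieAlgebra K;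
  quad_form : {bilinear quad_lie -> quad_lie -> K | *%R & *%R};
  quad_form_sym : forall x y, quad_form x y = quad_form y x;
  quad_form_nondeg : forall x, (forall y, quad_form x y = 0) -> x = 0;
  quad_form_inv : forall x y z,
    quad_form [lie x, y] z + quad_form y [lie x, z] = 0 }.

(* As for [prodv] in falgebra, spanning by brackets of basis vectors is enough;
   [lie_prodP] shows that this is the span of all [lie u, v], u \in U, v \in V. *)
Definition lie_prod (K : fieldType) (g : lieAlgebra K) (U V : {vspace g}) :
    {vspace g} :=
  <<allpairs (lie_bracket g) (vbasis U) (vbasis V)>>%VS.

Lemma memv_lie_prod (K : fieldType) (g : lieAlgebra K) (U V : {vspace g}) :
  {in U & V, forall u v, [lie u, v] \in lie_prod U V}.
Proof.
move=> u v /coord_vbasis-> /coord_vbasis->.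
rewrite linear_sumlz; apply: memv_suml => i _.
rewrite linear_sumr; apply: memv_suml => j _.
rewrite linearZl_LR linearZr_LR !memvZ // memv_span //.
by apply/allpairsP; exists ((vbasis U)`_i, (vbasis V)`_j); rewrite !memt_nth.
Qed.

Lemma lie_prodP (K : fieldType) (g : lieAlgebra K) (U V W : {vspace g}) :
  reflect {in U & V, forall u v, [lie u, v] \in W} (lie_prod U V <= W)%VS.
Proof.
apply: (iffP idP) => [sUVW u v Uu Vv | sUVW].
  by rewrite (subvP sUVW) ?memv_lie_prod.
apply/span_subvP=> _ /allpairsP[[u v] /= [Uu Vv ->]].
by rewrite sUVW ?vbasis_mem.
Qed.

Definition lie_sq (K : fieldType) (g : lieAlgebra K) : {vspace g} :=
  lie_prod fullv fullv.

Definition lie_cube (K : fieldType) (g : lieAlgebra K) : {vspace g} :=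
  lie_prod (lie_sq g) fullv.

Definition two_step_nilpotent (K : fieldType) (g : lieAlgebra K) : Prop :=
  lie_cube g = 0%VS /\ lie_sq g <> 0%VS.

Definition lie_type (K : fieldType) (g : lieAlgebra K) : nat :=
  (\dim {:g} - \dim (lie_sq g))%N.

Definition abelian_lie (K : fieldType) (g : lieAlgebra K) : Prop :=
  forall x y : g, [lie x, y] = 0.

Definition isometrically_isomorphic (K : fieldType) (g h : quadraticLie K) :
    Prop :=
  exists f : {linear g -> h},
    [/\ bijective f,
        forall x y : g, f [lie x, y] = [lie f x, f y]
      & forall x y : g, quad_form h (f x) (f y) = quad_form g x y].

Section DirectSum.
Variables (K : fieldType) (g h : quadraticLie K).

Definition dsum_bracket (x y : g * h) : g * h :=
  ([lie x.1, y.1], [lie x.2, y.2]).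

Fact dsum_bracket_bilinear : bilinear_for
  (GRing.Scale.Law.clone _ _ *:%R _) (GRing.Scale.Law.clone _ _ *:%R _)
  dsum_bracket.
Proof.
split=> [u'|u] a x y; rewrite /dsum_bracket /=.
  by rewrite !linearPl.
by rewrite !linearPr.
Qed.

HB.instance Definition _ := bilinear_isBilinear.Build K (g * h)%type
  (g * h)%type (g * h)%type _ _ dsum_bracket dsum_bracket_bilinear.

Fact dsum_bracket_alt x : dsum_bracket x x = 0.
Proof. by rewrite /dsum_bracket !lie_bracket_alt. Qed.

Fact dsum_jacobi x y z :
  dsum_bracket x (dsum_bracket y z) + dsum_bracket y (dsum_bracket z x)
    + dsum_bracket z (dsum_bracket x y) = 0.
Proof. by congr pair; apply: lie_jacobi. Qed.

Definition dsum_lie : lieAlgebra K :=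
  @LieAlgebra K (g * h)%type dsum_bracket dsum_bracket_alt dsum_jacobi.

Definition dsum_form (x y : dsum_lie) : K :=
  quad_form g x.1 y.1 + quad_form h x.2 y.2.

Fact dsum_form_bilinear : bilinear_for
  (GRing.Scale.Law.clone _ _ *%R _) (GRing.Scale.Law.clone _ _ *%R _)
  dsum_form.
Proof.
split=> [u'|u] a x y; rewrite /dsum_form /=.
  by rewrite !linearPl mulrDr addrACA.
by rewrite !linearPr mulrDr addrACA.
Qed.

HB.instance Definition _ := bilinear_isBilinear.Build K dsum_lie dsum_lie K
  _ _ dsum_form dsum_form_bilinear.

Fact dsum_form_sym x y : dsum_form x y = dsum_form y x.
Proof. by rewrite /dsum_form quad_form_sym [X in _ + X]quad_form_sym. Qed.

Fact dsum_form_nondeg x : (forall y, dsum_form x y = 0) -> x = 0.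
Proof.
case: x => x1 x2 x0; congr pair; apply: quad_form_nondeg => y.
  by have := x0 (y, 0); rewrite /dsum_form /= linear0r addr0.
by have := x0 (0, y); rewrite /dsum_form /= linear0r add0r.
Qed.

Fact dsum_form_inv x y z :
  dsum_form [lie x, y] z + dsum_form y [lie x, z] = 0.
Proof. by rewrite /dsum_form /= addrACA !quad_form_inv addr0. Qed.

Definition orthogonal_sum : quadraticLie K :=
  @QuadraticLie K dsum_lie dsum_form
    dsum_form_sym dsum_form_nondeg dsum_form_inv.

End DirectSum.

Section QuadraticFamily.
Variables (K : fieldType) (m : nat).
Implicit Type A : 'I_m -> 'M[K]_m.

Fact column_after_subproof (i : 'I_m) (j : 'I_(m - i.+1)) : (i.+1 + j < m)%N.
Proof. by rewrite -ltn_subRL. Qed.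

Definition column_after (i : 'I_m) (j : 'I_(m - i.+1)) : 'I_m :=
  Ordinal (column_after_subproof j).

(* Indices start at 0. The block of the last index has no column, so including
   it in the concatenation does not change the matrix. *)
Definition B_matrix A : 'M[K]_(m, \sum_(i < m) (m - i.+1)) :=
  \mxrow_(i < m) colsub (@column_after i) (A i).

Record quadratic_family A : Prop := QuadraticFamily {
  qf_size : (2 <= m)%N;
  qf_skew : forall i, (A i)^T = - A i;
  qf_diag : forall i, col i (A i) = 0;
  qf_swap : forall i j : 'I_m, (i < j)%N -> col j (A i) = - col i (A j);
  qf_rank : \rank (B_matrix A) = m }.

End QuadraticFamily.

Section Attached.
Variables (K : fieldType) (m : nat) (A : 'I_m -> 'M[K]_m).
Hypothesis Aquad : quadratic_family A.

(* A pair (a, b) stands for \sum_i a_i v_i + \sum_i b_i z_i. *)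
Let space := ('rV[K]_m * 'rV[K]_m)%type.

Definition attached_bracket (x y : space) : space :=
  (0, \sum_i \sum_j (x.1 0 i * y.1 0 j) *: (col j (A i))^T).

Fact attached_bracket_bilinear : bilinear_for
  (GRing.Scale.Law.clone _ _ *:%R _) (GRing.Scale.Law.clone _ _ *:%R _)
  attached_bracket.
Proof.
split=> [u'|u] a x y; rewrite /attached_bracket /=; congr pair;
  rewrite /= ?scaler0 ?addr0 // scaler_sumr -big_split /=;
  apply: eq_bigr => i _; rewrite scaler_sumr -big_split /=;
  apply: eq_bigr => j _; rewrite !mxE scalerA -scalerDl; congr (_ *: _).
  by rewrite mulrDl mulrA.
by rewrite mulrDr mulrCA.
Qed.

HB.instance Definition _ := bilinear_isBilinear.Build K space space space
  _ _ attached_bracket attached_bracket_bilinear.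

Fact attached_bracket_alt x : attached_bracket x x = 0.
Proof.
congr pair; rewrite /= pair_big /=.
rewrite (bigID (fun p : 'I_m * 'I_m => p.1 < p.2)%N) /=.
rewrite [X in _ + X](bigID (fun p : 'I_m * 'I_m => p.2 < p.1)%N) /=.
rewrite [X in _ + (_ + X)]big1 ?addr0; last first.
  case=> i j /=; rewrite -!leqNgt => /andP[le_ji le_ij].
  have -> : j = i by apply/val_inj/anti_leq; rewrite le_ji le_ij.
  by rewrite (qf_diag Aquad) trmx0 scaler0.
pose swap (p : 'I_m * 'I_m) := (p.2, p.1).
rewrite [X in _ + X](reindex_onto swap swap) /=; last by case.
rewrite [X in _ + X](eq_bigl (fun p : 'I_m * 'I_m => p.1 < p.2)%N); last first.
  by case=> i j /=; rewrite eqxx andbT -leqNgt andb_idl // => /ltnW.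
rewrite -big_split big1 // => -[i j] /= lt_ij.
by rewrite (qf_swap Aquad lt_ij) linearN /= scalerN mulrC addNr.
Qed.

Fact attached_jacobi x y z :
  attached_bracket x (attached_bracket y z)
    + attached_bracket y (attached_bracket z x)
    + attached_bracket z (attached_bracket x y) = 0.
Proof.
have brk0 u v w : attached_bracket u (attached_bracket v w) = 0.
  congr pair; apply: big1 => i _; apply: big1 => j _ /=.
  by rewrite mxE mulr0 scale0r.
by rewrite !brk0 !addr0.
Qed.

Definition attached_lie : lieAlgebra K :=
  @LieAlgebra K space attached_bracket attached_bracket_alt attached_jacobi.

Definition attached_form (x y : attached_lie) : K :=
  \sum_i (x.1 0 i * y.2 0 i + x.2 0 i * y.1 0 i).

Fact attached_form_bilinear : bilinear_for
  (GRing.Scale.Law.clone _ _ *%R _) (GRing.Scale.Law.clone _ _ *%R _)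
  attached_form.
Proof.
split=> [u'|u] a x y; rewrite /attached_form /= mulr_sumr -big_split /=;
  apply: eq_bigr => i _; rewrite !mxE [a * (_ + _)]mulrDr addrACA.
  by rewrite !mulrDl !mulrA.
by rewrite !mulrDr ![a * (_ * _)]mulrCA.
Qed.

HB.instance Definition _ := bilinear_isBilinear.Build K attached_lie
  attached_lie K _ _ attached_form attached_form_bilinear.

Fact attached_form_sym x y : attached_form x y = attached_form y x.
Proof.
by apply: eq_bigr => i _; rewrite addrC [x.2 _ _ * _]mulrC [x.1 _ _ * _]mulrC.
Qed.

Definition attached_v (i : 'I_m) : attached_lie := (delta_mx 0 i, 0).
Definition attached_z (i : 'I_m) : attached_lie := (0, delta_mx 0 i).

Lemma attached_form_v x i : attached_form x (attached_v i) = x.2 0 i.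
Proof.
rewrite /attached_form (bigD1 i) //= big1 => [|j /negPf ne_ji].
  by rewrite !mxE !eqxx mulr0 add0r mulr1 addr0.
by rewrite !mxE ne_ji andbF !mulr0 addr0.
Qed.

Lemma attached_form_z x i : attached_form x (attached_z i) = x.1 0 i.
Proof.
rewrite /attached_form (bigD1 i) //= big1 => [|j /negPf ne_ji].
  by rewrite !mxE !eqxx mulr0 !addr0 mulr1.
by rewrite !mxE ne_ji andbF !mulr0 addr0.
Qed.

Fact attached_form_nondeg x : (forall y, attached_form x y = 0) -> x = 0.
Proof.
case: x => x1 x2 x0; congr pair; apply/rowP => i; rewrite mxE.
  by rewrite -(x0 (attached_z i)) attached_form_z.
by rewrite -(x0 (attached_v i)) attached_form_v.
Qed.

Fact attached_form_inv x y z :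
  attached_form [lie x, y] z + attached_form y [lie x, z] = 0.
Proof.
pose T k := \sum_i \sum_j x.1 0 i * y.1 0 j * A i k j * z.1 0 k.
pose T' k := \sum_i \sum_j y.1 0 k * (x.1 0 i * z.1 0 j * A i k j).
have -> : attached_form [lie x, y] z = \sum_k T k.
  apply: eq_bigr => k _ /=; rewrite !mxE mul0r add0r summxE mulr_suml.
  apply: eq_bigr => i _; rewrite summxE mulr_suml.
  by apply: eq_bigr => j _; rewrite !mxE.
have -> : attached_form y [lie x, z] = \sum_k T' k.
  apply: eq_bigr => k _ /=; rewrite !mxE mulr0 addr0 summxE mulr_sumr.
  apply: eq_bigr => i _; rewrite summxE mulr_sumr.
  by apply: eq_bigr => j _; rewrite !mxE.
rewrite /T /T' exchange_big [X in _ + X]exchange_big -big_split big1 //= => i _.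
rewrite [X in _ + X]exchange_big -big_split big1 //= => k _.
rewrite -big_split big1 //= => j _.
have /matrixP/(_ j k) := qf_skew Aquad i; rewrite !mxE => ->.
rewrite mulrN mulNr !mulrA [y.1 0 j * _]mulrC.
by rewrite [X in _ + X]mulrAC addNr.
Qed.

Definition attached_quad : quadraticLie K :=
  @QuadraticLie K attached_lie attached_form
    attached_form_sym attached_form_nondeg attached_form_inv.

Lemma attached_bracket_vv i j :
  [lie attached_v i, attached_v j] = \sum_k A i k j *: attached_z k.
Proof.
have -> : \sum_k A i k j *: attached_z k
    = (0, \sum_k A i k j *: delta_mx 0 k) :> space.
  elim/big_rec2: _ => [|k v u _ ->] //; congr pair; rewrite /= scaler0.
  by rewrite addr0.
congr pair; rewrite /= (bigD1 i) //= (bigD1 j) //= [X in _ + X]big1.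
  rewrite [X in _ + X + _]big1 => [|k /negPf ne_kj].
    rewrite !mxE !eqxx mulr1 scale1r !addr0 [LHS]row_sum_delta.
    by apply: eq_bigr => k _; rewrite !mxE.
  by rewrite !mxE ne_kj andbF mulr0 scale0r.
move=> k /negPf ne_ki; apply: big1 => l _.
by rewrite !mxE ne_ki andbF mul0r scale0r.
Qed.

Lemma attached_bracket_z x i : [lie x, attached_z i] = 0.
Proof.
congr pair; apply: big1 => k _; apply: big1 => j _ /=.
by rewrite mxE mulr0 scale0r.
Qed.

End Attached.

(* Main.v *)
From HB Require Import structures.
Require Import Defs.
From mathcomp Require Import all_boot all_order all_algebra.
From mathcomp Require Import ring.
Set Implicit Arguments.
Unset Strict Implicit.
Unset Printing Implicit Defensive.
Import GRing.Theory.
Local Open Scope ring_scope.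

(** If g is quadratic and 2-step nilpotent then g^2 is central, hence totally
    isotropic, since invariance makes g^2 orthogonal to the centre. A basis
    (z_i) of g^2 has a dual family, which can be corrected by elements of g^2
    (dividing by 2) into a totally isotropic dual family (v_i). The orthogonal
    complement a of the hyperbolic space spanned by the v_i and z_i is
    orthogonal to g^2, hence central, so g is n(A) + a where A is read off the
    alternating 3-tensor phi([v_i, v_j], v_k). The rank condition says that
    this tensor has no kernel, which excludes m = 1, 2 (the tensor vanishes)
    and m = 4 (a 3-form in dimension 4 always has a kernel). Conversely the
    rank condition gives dim n(A)^2 = m, hence the type of n(A) + a; existence
    comes from the cross product on K^3. *)

(** * Alternating 3-tensors and quadratic families *)

Section AlternatingTensors.
Variables (K : fieldType) (m : nat).
Implicit Types (T : 'I_m -> 'I_m -> 'I_m -> K) (A : 'I_m -> 'M[K]_m).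

Definition alternating T :=
  [/\ forall i j k, T i j k = - T j i k,
      forall i j k, T i j k = - T i k j
    & forall i k, T i i k = 0].

Definition tensor_nondegenerate T := forall w : 'rV[K]_m,
  (forall i j, \sum_k w 0 k * T i j k = 0) -> w = 0.

Definition tensor_family T (i : 'I_m) : 'M[K]_m := \matrix_(k, j) T i j k.

(** [B_matrix] only contains the columns j > i of each A_i. The swap condition recovers the columns
    j < i up to sign and the diagonal condition gives the columns j = i, so a row vector killing
    [B_matrix] kills every column of every A_i. *)
Lemma rank_B_matrix A :
  (forall i, col i (A i) = 0) ->
  (forall i j : 'I_m, (i < j)%N -> col j (A i) = - col i (A j)) ->
  (forall w : 'rV[K]_m, (forall i j, \sum_k w 0 k * A i k j = 0) -> w = 0) ->
  \rank (B_matrix A) = m.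
Proof.
move=> diagA swapA ndA; apply/eqP/inj_row_free => w wB.
have lt_ij (i j : 'I_m) : (i < j)%N -> \sum_k w 0 k * A i k j = 0.
  (* Column j of A_i sits at position j - (i + 1) of block i. *)
  move=> ij; have jP : (j - i.+1 < m - i.+1)%N.
    by rewrite ltn_sub2r // (leq_ltn_trans ij).
  have /(congr1 (fun M => submxrow M i 0 (Ordinal jP))) := wB.
  rewrite /B_matrix mul_mxrow mxrowK [RHS]mxE [RHS]mxE => {2}<-.
  rewrite mxE; apply: eq_bigr => k _; rewrite mxE; congr (_ * A i k _).
  by apply: val_inj; rewrite /= subnKC.
apply: ndA => i j; case: (ltngtP i j) => [/lt_ij //|ji|/val_inj <-].
  rewrite -[RHS]oppr0 -[in RHS](lt_ij _ _ ji) -sumrN; apply: eq_bigr => k _.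
  have /colP/(_ k) := swapA _ _ ji; rewrite !mxE => ->.
  by rewrite mulrN opprK.
apply: big1 => k _; have /colP/(_ k) := diagA i; rewrite !mxE => ->.
by rewrite mulr0.
Qed.

Lemma tensor_quadratic_family T : alternating T -> tensor_nondegenerate T ->
  (2 <= m)%N -> quadratic_family (tensor_family T).
Proof.
move=> [T12 T23 T0] ndT m2.
have diagT i : col i (tensor_family T i) = 0.
  by apply/colP => k; rewrite !mxE T0.
have swapT i j : col j (tensor_family T i) = - col i (tensor_family T j).
  by apply/colP => k; rewrite !mxE T12.
split=> // [i|]; first by apply/matrixP => k j; rewrite !mxE T23.
apply: rank_B_matrix => // w w0; apply: ndT => i j.
by rewrite -[RHS](w0 i j); apply: eq_bigr => k _; rewrite mxE.
Qed.
End AlternatingTensors.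

Lemma alternating_dim (K : fieldType) m (T : 'I_m -> 'I_m -> 'I_m -> K) :
  alternating T -> tensor_nondegenerate T -> (0 < m)%N ->
  (3 <= m)%N /\ m <> 4%N.
Proof.
move=> [T12 T23 T0] ndT m_gt0.
have T0r i k : T i k k = 0 by rewrite T12 T23 T0 !oppr0.
have T0m i j : T i j i = 0 by rewrite T23 T0 oppr0.
(* The zero tensor has the all-ones vector in its kernel, and that vector is nonzero because 0 <
   m. *)
have Tn0 : ~ (forall i j k, T i j k = 0).
  move=> Tz; have /rowP/(_ (Ordinal m_gt0)) : const_mx 1 = 0 :> 'rV[K]_m.
    by apply: ndT => i j; apply: big1 => k _; rewrite Tz mulr0.
  by rewrite !mxE; apply/eqP/oner_neq0.
split.
  (* With at most two indices no three are distinct, and T vanishes on repeated ones. *)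
  rewrite ltnNge; apply/negP => m_le2; apply: Tn0 => i j k.
  have [->|ne_ij] := eqVneq i j; first exact: T0.
  have [->|ne_ik] := eqVneq i k; first exact: T0m.
  have [->|ne_jk] := eqVneq j k; first exact: T0r.
  have : uniq [:: i; j; k] by rewrite /= !inE negb_or ne_ij ne_ik ne_jk.
  move/card_uniqP => /= c3; have := max_card [in [:: i; j; k]].
  by rewrite c3 card_ord leqNgt ltnS m_le2.
move=> m4; subst m; apply: Tn0.
pose o k (lt_k4 : (k < 4)%N) := Ordinal lt_k4.
pose o0 := @o 0 isT; pose o1 := @o 1 isT; pose o2 := @o 2 isT.
pose o3 := @o 3 isT.
have ord4P (P : 'I_4 -> Prop) : P o0 -> P o1 -> P o2 -> P o3 -> forall i, P i.
  by move=> ? ? ? ? [[|[|[|[|//]]]] lti]; rewrite (bool_irrelevance lti isT).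
(* Antisymmetry is instantiated at decreasing pairs only, so rewriting sorts the indices and
   terminates. *)
pose sortT := (T0, T0r, T0m,
  (T12 o1 o0, T12 o2 o0, T12 o3 o0, T12 o2 o1, T12 o3 o1, T12 o3 o2),
  (fun i => T23 i o1 o0, fun i => T23 i o2 o0, fun i => T23 i o3 o0,
   fun i => T23 i o2 o1, fun i => T23 i o3 o1, fun i => T23 i o3 o2)).
(* A 3-form on a 4-space is the contraction of a volume form by a vector,
   which then lies in its kernel. *)
pose w : 'rV[K]_4 := \row_k [:: T o1 o2 o3; - T o0 o2 o3; T o0 o1 o3;
                                - T o0 o1 o2]`_k.
have w0 : w = 0.
  apply: ndT => i j; rewrite !big_ord_recl big_ord0.
  rewrite !mxE /=.
  have -> : ord0 = o0 by apply: val_inj.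
  have -> : lift o0 ord0 = o1 by apply: val_inj.
  have -> : lift o0 (lift ord0 ord0) = o2 by apply: val_inj.
  have -> : lift o0 (lift ord0 (lift ord0 ord0)) = o3 by apply: val_inj.
  by elim/ord4P: i; elim/ord4P: j; rewrite !sortT; ring.
(* The entries of T at increasing indices determine T, and up to sign they are the entries of
   [w]. *)
have [[[w3 w2] w1] w4] : ((T o1 o2 o3 = 0) * (T o0 o2 o3 = 0) *
    (T o0 o1 o3 = 0) * (T o0 o1 o2 = 0))%type.
  have wE k : w 0 k = 0 by rewrite w0 mxE.
  have [[[+ +] +] +] := (wE o0, wE o1, wE o2, wE o3); rewrite !mxE /=.
  by move=> -> /eqP + -> /eqP; rewrite !oppr_eq0 => /eqP-> /eqP->.
by elim/ord4P=> j k; elim/ord4P: j; elim/ord4P: k;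
   rewrite ?sortT ?(w1, w2, w3, w4) ?oppr0.
Qed.

Lemma cross_product_tensor (K : fieldType) :
  exists2 T : 'I_3 -> 'I_3 -> 'I_3 -> K, alternating T
    & tensor_nondegenerate T.
Proof.
(* Addition in ['I_3] is modulo 3, so this is the Levi-Civita symbol. *)
pose T (i j k : 'I_3) : K :=
  (j == i + 1)%:R * (k == i + 2)%:R - (k == i + 1)%:R * (j == i + 2)%:R.
exists T.
  split=> [i j k|i j k|i k]; rewrite /T.
  - by case: i j k => [[|[|[]]] //= ?] [[|[|[]]] //= ?] [[|[|[]]] //= ?]; ring.
  - by rewrite opprB.
  - by case: i k => [[|[|[]]] //= ?] [[|[|[]]] //= ?]; ring.
(* Contracting at (k + 1, k + 2) isolates w_k, because (k + 1, k + 2, k) is a cyclic permutation. *)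
move=> w w0; apply/rowP => k; rewrite mxE -[RHS](w0 (k + 1) (k + 2)).
rewrite (bigD1 k) //= big1 /T => [|l ne_lk].
  by case: k => [[|[|[]]] //= ?]; ring.
by case: k l ne_lk => [[|[|[]]] //= ?] [[|[|[]]] //= ?] _; ring.
Qed.

(** * Quadratic abelian Lie algebras *)

Section AbelianQuadratic.
Variables (K : fieldType) (V : vectType K).

Definition zero_bracket (x y : V) : V := 0.

Fact zero_bracket_bilinear : bilinear_for
  (GRing.Scale.Law.clone _ _ *:%R _) (GRing.Scale.Law.clone _ _ *:%R _)
  zero_bracket.
Proof. by split=> ? ? ? ?; rewrite /zero_bracket /= scaler0 addr0. Qed.

HB.instance Definition _ := bilinear_isBilinear.Build K V V V _ _ zero_bracket
  zero_bracket_bilinear.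

Fact zero_bracket_jacobi x y z :
  zero_bracket x (zero_bracket y z) + zero_bracket y (zero_bracket z x)
    + zero_bracket z (zero_bracket x y) = 0.
Proof. by rewrite /zero_bracket !addr0. Qed.

Definition zero_lie : lieAlgebra K :=
  @LieAlgebra K V zero_bracket (fun=> erefl) zero_bracket_jacobi.

Variable phi : {bilinear V -> V -> K | *%R & *%R}.
Hypothesis phi_sym : forall x y, phi x y = phi y x.
Hypothesis phi_nondeg : forall x, (forall y, phi x y = 0) -> x = 0.

Fact zero_lie_form_inv (x y z : zero_lie) :
  phi [lie x, y] z + phi y [lie x, z] = 0.
Proof. by rewrite linear0l linear0r addr0. Qed.

Definition abelian_quad : quadraticLie K :=
  @QuadraticLie K zero_lie phi phi_sym phi_nondeg zero_lie_form_inv.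

End AbelianQuadratic.

Section DotProduct.
Variables (K : fieldType) (n : nat).

Definition dot_form (x y : 'rV[K]_n) : K := \sum_i x 0 i * y 0 i.

Fact dot_form_bilinear : bilinear_for
  (GRing.Scale.Law.clone _ _ *%R _) (GRing.Scale.Law.clone _ _ *%R _) dot_form.
Proof.
split=> [u'|u] a x y; rewrite /dot_form /= mulr_sumr -big_split /=;
  by apply: eq_bigr => i _; rewrite !mxE; ring.
Qed.

HB.instance Definition _ := bilinear_isBilinear.Build K 'rV[K]_n 'rV[K]_n K
  _ _ dot_form dot_form_bilinear.

Fact dot_form_sym x y : dot_form x y = dot_form y x.
Proof. by apply: eq_bigr => i _; rewrite mulrC. Qed.

Fact dot_form_nondeg x : (forall y, dot_form x y = 0) -> x = 0.
Proof.
move=> x0; apply/rowP => i; rewrite mxE -(x0 (delta_mx 0 i)).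
rewrite /dot_form (bigD1 i) //= big1 => [|j /negPf ne_ji].
  by rewrite mxE !eqxx mulr1 addr0.
by rewrite mxE ne_ji andbF mulr0.
Qed.

(** Provides an abelian summand of any dimension, which raises the type of the cross product example
    from 3 to d. *)
Definition dot_quad : quadraticLie K :=
  abelian_quad dot_form_sym dot_form_nondeg.

Lemma dim_dot_quad : \dim {:dot_quad} = n.
Proof. by rewrite dimvf /dim /= mul1n. Qed.

End DotProduct.

(** * Invariance of the type and of 2-step nilpotency under isomorphism *)

Section LieMorphism.
Variables (K : fieldType) (g h : lieAlgebra K) (f : {linear g -> h}).
Hypothesis f_lie : forall x y : g, f [lie x, y] = [lie f x, f y].

Lemma limg_lie_prod (U V : {vspace g}) :
  (linfun f @: lie_prod U V)%VS
    = lie_prod (linfun f @: U)%VS (linfun f @: V)%VS.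
Proof.
apply/eqP; rewrite eqEsubv; apply/andP; split.
  rewrite limg_span; apply/span_subvP => x.
  case/mapP=> [w /allpairsP[[u v] /= [Uu Vv ->]] ->].
  rewrite lfunE /= f_lie memv_lie_prod // -[f _](lfunE f) memv_img //;
    exact: vbasis_mem.
apply/lie_prodP => _ _ /memv_imgP[u Uu ->] /memv_imgP[v Vv ->].
by rewrite !lfunE /= -f_lie -[f _](lfunE f) memv_img ?memv_lie_prod.
Qed.

Hypothesis f_bij : bijective f.

Let ker0 : lker (linfun f) == 0%VS.
Proof. by apply/lker0P => x y; rewrite !lfunE => /(bij_inj f_bij). Qed.

Lemma limg_lie_iso : limg (linfun f) = fullv.
Proof.
case: f_bij => f' _ f'K; apply/eqP; rewrite eqEsubv subvf; apply/subvP => y _.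
by rewrite -[y]f'K -[f _](lfunE f) memv_img ?memvf.
Qed.

Lemma lie_iso_two_step : two_step_nilpotent h -> two_step_nilpotent g.
Proof.
(* Writing the whole of h as the image of f turns h^2 and h^3 into the images of g^2 and g^3, and f
   is injective. *)
rewrite /two_step_nilpotent /lie_cube /lie_sq -limg_lie_iso -!limg_lie_prod.
case=> cube0 sq_n0; split.
  by apply/eqP; rewrite -(eq_limg_ker0 _ _ ker0) cube0 limg0.
by move=> sq0; apply: sq_n0; rewrite sq0 limg0.
Qed.

Lemma lie_iso_type : lie_type g = lie_type h.
Proof.
rewrite /lie_type /lie_sq -limg_lie_iso -limg_lie_prod.
by rewrite !limg_dim_eq ?(eqP ker0) ?capv0.
Qed.

End LieMorphism.

(** * The derived algebra and the type of n(A) + a *)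

Section AttachedSum.
Variables (K : fieldType) (m : nat) (A : 'I_m -> 'M[K]_m).
Variables (Aquad : quadratic_family A) (a : quadraticLie K).
Hypothesis a_abelian : abelian_lie a.

Local Notation h := (orthogonal_sum (attached_quad Aquad) a).

Definition z_embedding (b : 'rV[K]_m) : h := (0, b, 0).

Fact z_embedding_linear : linear z_embedding.
Proof.
by move=> k b c; congr (_, _, _); rewrite /= ?scaler0 ?addr0.
Qed.

HB.instance Definition _ := GRing.isLinear.Build K 'rV[K]_m h _ z_embedding
  z_embedding_linear.

(** The columns of [B_matrix] are the z-coordinates of the brackets [v_i, v_j] with i < j. Rank m
    says that they span all of K^m, so every z_k lies in the derived algebra. *)
Lemma attached_sum_sq : lie_sq h = limg (linfun z_embedding).
Proof.
apply/eqP; rewrite eqEsubv; apply/andP; split.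
  apply/lie_prodP => x y _ _.
  have -> : [lie x, y] = linfun z_embedding ([lie x.1, y.1]).2.
    by rewrite lfunE; congr pair; apply: a_abelian.
  exact: memv_img (memvf _).
apply/subvP => _ /memv_imgP[b _ ->]; rewrite lfunE /=.
have : row_full (B_matrix A)^T by rewrite /row_full mxrank_tr (qf_rank Aquad).
(* The left inverse [C] of the transpose of B expresses b as a combination of columns of B. The
   index [l] of such a column is then decoded into a block i and a position in that block. *)
case/row_fullP => C BC; rewrite -[b]mulmx1 -BC mulmxA mulmx_sum_row linear_sum.
apply: memv_suml => l _; rewrite linearZ memvZ //= -tr_col col_mxrow.
set i := tagnat.sig1 l; set j := column_after (tagnat.sig2 l).
have -> : z_embedding (col (tagnat.sig2 l) (colsub (@column_after _ i) (A i)))^T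
   = [lie (attached_v Aquad i, 0) : h, (attached_v Aquad j, 0) : h].
  congr pair; last by rewrite a_abelian.
  congr pair; rewrite (bigD1 i) //= (bigD1 j) //= big1 => [|k /negPf ne_kj].
    rewrite big1 => [|k /negPf ne_ki].
      rewrite !addr0 !mxE !eqxx mulr1 scale1r.
      by apply/rowP => k; rewrite !mxE.
    by apply: big1 => k' _; rewrite !mxE ne_ki andbF mul0r scale0r.
  by rewrite !mxE ne_kj andbF mulr0 scale0r.
exact: (@memv_lie_prod K h fullv fullv _ _ (memvf _) (memvf _)).
Qed.

Lemma dim_attached_sum_sq : \dim (lie_sq h) = m.
Proof.
rewrite attached_sum_sq limg_dim_eq; first by rewrite dimvf /dim /= mul1n.
suff /eqP-> : lker (linfun z_embedding) == 0%VS by rewrite capv0.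
by apply/lker0P => b c; rewrite !lfunE => -[].
Qed.

Lemma attached_sum_type : lie_type h = (m + \dim {:a})%N.
Proof.
rewrite /lie_type dim_attached_sum_sq !dimvf.
have -> : dim h = (1 * m + 1 * m + dim a)%N by [].
by rewrite mul1n -addnA addKn.
Qed.

Lemma attached_sum_two_step : two_step_nilpotent h.
Proof.
split.
  apply/eqP; rewrite -subv0; apply/lie_prodP => x y.
  rewrite attached_sum_sq => /memv_imgP[b _ ->] _; rewrite lfunE memv0.
  apply/eqP; congr pair; last by rewrite a_abelian.
  congr pair; apply: big1 => i _; apply: big1 => j _.
  by rewrite mxE mul0r scale0r.
move=> sq0; have := qf_size Aquad.
by rewrite -dim_attached_sum_sq sq0 dimv0.
Qed.

End AttachedSum.

(** * Dual families for a nondegenerate symmetric form *)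

Section DualFamilies.
Variables (K : fieldType) (V : vectType K).
Variable phi : {bilinear V -> V -> K | *%R & *%R}.
Hypothesis phi_sym : forall x y, phi x y = phi y x.
Hypothesis phi_nondeg : forall x, (forall y, phi x y = 0) -> x = 0.

(** The Gram matrix of a basis of V against z has independent columns: a relation between them is a
    combination of the z_i orthogonal to V, hence zero, hence trivial as z is free. A left inverse
    contains the coordinates of the v_i. *)
Lemma dual_family m (z : m.-tuple V) : free z ->
  exists v : 'I_m -> V, forall i j : 'I_m, phi (v i) z`_j = (i == j)%:R.
Proof.
move=> /freeP free_z; pose e := vbasis {:V}.
pose M : 'M[K]_(_, m) := \matrix_(k < \dim {:V}, i < m) phi e`_k z`_i.
have : row_full M.
  rewrite /row_full -mxrank_tr; apply: inj_row_free => c cM0.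
  apply/rowP => i; rewrite [RHS]mxE; apply: (free_z (c 0)).
  apply: phi_nondeg => y; rewrite phi_sym (coord_vbasis (memvf y)) linear_sumlz.
  apply: big1 => k _; rewrite linearZl_LR linear_sumr /=.
  have /rowP/(_ k) := cM0; rewrite !mxE => c0.
  rewrite -[RHS](mulr0 (coord e k y)); congr (_ * _); rewrite -[RHS]c0.
  by apply: eq_bigr => l _; rewrite linearZr_LR !mxE /=.
case/row_fullP => N NM; exists (fun i => \sum_k N i k *: e`_k) => i j.
have /matrixP/(_ i j) := NM; rewrite !mxE => <-.
by rewrite linear_sumlz; apply: eq_bigr => k _; rewrite linearZl_LR mxE.
Qed.

Lemma isotropic_dual_family m (z : m.-tuple V) : 2%:R != 0 :> K -> free z ->
  (forall i j : 'I_m, phi z`_i z`_j = 0) ->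
  exists v : 'I_m -> V, (forall i j : 'I_m, phi (v i) z`_j = (i == j)%:R)
    /\ (forall i j, phi (v i) (v j) = 0).
Proof.
move=> two_n0 /dual_family[u uz] zz.
(* Subtracting [s i] preserves the pairing with z, since z is isotropic. In phi(u_i - s_i, u_j -
   s_j) each of the two cross terms removes half of phi(u_i, u_j), and phi(s_i, s_j) = 0. *)
pose s i := \sum_(k < m) (2%:R^-1 * phi (u i) (u k)) *: z`_k.
have sz i (j : 'I_m) : phi (s i) z`_j = 0.
  by rewrite linear_sumlz big1 // => k _; rewrite linearZl_LR /= zz mulr0.
have us i j : phi (u i) (s j) = 2%:R^-1 * phi (u i) (u j).
  rewrite linear_sumr (bigD1 i) //= big1 => [|k /negPf ne_ki].
    by rewrite linearZr_LR /= uz eqxx mulr1 addr0 phi_sym.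
  by rewrite linearZr_LR /= uz eq_sym ne_ki mulr0.
have ss i j : phi (s i) (s j) = 0.
  by rewrite linear_sumr big1 // => k _; rewrite linearZr_LR /= sz mulr0.
exists (fun i => u i - s i); split=> i j; first by rewrite linearBl /= sz subr0.
rewrite linearBl !linearBr /= ss us (phi_sym (s i)) us (phi_sym (u j)).
by field.
Qed.

End DualFamilies.

(** * Splitting a quadratic 2-step nilpotent Lie algebra *)

Section Decomposition.
Variables (K : fieldType) (g : quadraticLie K).
Hypothesis g_two_step : two_step_nilpotent g.

Local Notation phi := (quad_form g).
Local Notation m := (\dim (lie_sq g)).
Local Notation z := (vbasis (lie_sq g)).

Lemma lie_sq_central (x y : g) : x \in lie_sq g -> [lie x, y] = 0.
Proof.
case: g_two_step => cube0 _ sq_x; apply/eqP; rewrite -memv0 -cube0.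
exact: memv_lie_prod sq_x (memvf _).
Qed.

Lemma lie_skew (x y : g) : [lie x, y] = - [lie y, x].
Proof.
apply/eqP; rewrite -addr_eq0; have := lie_bracket_alt (x + y).
by rewrite linearDl !linearDr /= !lie_bracket_alt add0r addr0 => ->.
Qed.

Lemma mem_lie_sq (x y : g) : [lie x, y] \in lie_sq g.
Proof. exact: memv_lie_prod (memvf _) (memvf _). Qed.

(** By invariance phi([x, y], w) = - phi(y, [x, w]), and [x, w] is a combination of the z_i. *)
Lemma orthogonal_central (y : g) : (forall i : 'I_m, phi y z`_i = 0) ->
  forall x, [lie x, y] = 0.
Proof.
move=> yz x; apply: (quad_form_nondeg (q := g)) => w.
have /eqP := quad_form_inv x y w; rewrite addr_eq0 => /eqP->.
rewrite (coord_vbasis (mem_lie_sq x w)) linear_sumr big1 ?oppr0 // => i _.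
by rewrite linearZr_LR /= yz mulr0.
Qed.

Lemma orthogonal_lie_sq (x y : g) : (forall u w, phi [lie u, w] y = 0) ->
  x \in lie_sq g -> phi x y = 0.
Proof.
move=> y0.
pose X := in_tuple (allpairs (lie_bracket g) (vbasis fullv) (vbasis fullv)).
move=> sq_x; rewrite (coord_span (X := X) sq_x) linear_sumlz big1 // => i _.
rewrite linearZl_LR /=; have /allpairsP[p [_ _ ->]] := memt_nth 0 X (ltn_ord i).
by rewrite y0 mulr0.
Qed.

Lemma lie_sq_isotropic (x y : g) : x \in lie_sq g -> y \in lie_sq g ->
  phi x y = 0.
Proof.
move=> sq_x sq_y; apply: orthogonal_lie_sq sq_x => u w.
have /eqP := quad_form_inv u w y; rewrite addr_eq0 => /eqP->.
by rewrite lie_skew lie_sq_central // oppr0 linear0r oppr0.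
Qed.

(** * Hyperbolic coordinates and the orthogonal complement *)

Variable v : 'I_m -> g.
Hypothesis v_z : forall i j : 'I_m, phi (v i) z`_j = (i == j)%:R.
Hypothesis v_v : forall i j, phi (v i) (v j) = 0.

Let z_v (i j : 'I_m) : phi z`_i (v j) = (i == j)%:R.
Proof. by rewrite quad_form_sym v_z eq_sym. Qed.

Let z_z (i j : 'I_m) : phi z`_i z`_j = 0.
Proof. by apply: lie_sq_isotropic; apply: vbasis_mem; apply: memt_nth. Qed.

(** Coefficients are read off by duality: the one on v_i is the pairing with z_i, and the one on z_i
    is the pairing with v_i. *)
Definition v_coord (x : g) : 'rV[K]_m := \row_i phi x z`_i.
Definition z_coord (x : g) : 'rV[K]_m := \row_i phi x (v i).
Definition hyperbolic (p q : 'rV[K]_m) : g :=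
  \sum_i p 0 i *: v i + \sum_i q 0 i *: z`_i.
(** The orthogonal projection away from the hyperbolic space; its image is the future abelian
    summand. *)
Definition residue (x : g) : g := x - hyperbolic (v_coord x) (z_coord x).

Let v_coord_linear : linear v_coord.
Proof. by move=> k x y; apply/rowP => i; rewrite !mxE linearPl. Qed.
Let z_coord_linear : linear z_coord.
Proof. by move=> k x y; apply/rowP => i; rewrite !mxE linearPl. Qed.
Let hyperbolic_linear k p q p' q' :
  hyperbolic (k *: p + p') (k *: q + q')
    = k *: hyperbolic p q + hyperbolic p' q'.
Proof.
rewrite /hyperbolic scalerDr addrACA !scaler_sumr.
by congr (_ + _); rewrite -big_split; apply: eq_bigr => i _;
  rewrite !mxE scalerDl scalerA.
Qed.

Fact residue_linear : linear residue.
Proof.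
move=> k x y; rewrite /residue v_coord_linear z_coord_linear hyperbolic_linear.
by rewrite scalerBr opprD addrACA.
Qed.

HB.instance Definition _ := GRing.isLinear.Build K g g _ residue residue_linear.

Lemma form_hyperbolic x p q :
  phi x (hyperbolic p q)
    = \sum_i (v_coord x 0 i * q 0 i + z_coord x 0 i * p 0 i).
Proof.
rewrite linearDr !linear_sumr -big_split; apply: eq_bigr => i _ /=.
by rewrite !linearZr_LR /= !mxE addrC ![_ * phi _ _]mulrC.
Qed.

Lemma v_coord_hyperbolic p q : v_coord (hyperbolic p q) = p.
Proof.
apply/rowP => i; rewrite mxE quad_form_sym form_hyperbolic (bigD1 i) //=.
rewrite big1 => [|j /negPf ne_ji]; rewrite !mxE z_z z_v mul0r add0r.
  by rewrite eqxx mul1r addr0.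
by rewrite eq_sym ne_ji mul0r.
Qed.

Lemma z_coord_hyperbolic p q : z_coord (hyperbolic p q) = q.
Proof.
apply/rowP => i; rewrite mxE quad_form_sym form_hyperbolic (bigD1 i) //=.
rewrite big1 => [|j /negPf ne_ji]; rewrite !mxE v_v v_z mul0r addr0.
  by rewrite eqxx mul1r addr0.
by rewrite eq_sym ne_ji mul0r.
Qed.

Let subr_linear (f : g -> 'rV[K]_m) x y : linear f -> f (x - y) = f x - f y.
Proof. by move=> f_lin; rewrite -scaleN1r addrC f_lin scaleN1r addrC. Qed.

Lemma v_coord_residue x : v_coord (residue x) = 0.
Proof. by rewrite subr_linear // v_coord_hyperbolic subrr. Qed.

Lemma z_coord_residue x : z_coord (residue x) = 0.
Proof. by rewrite subr_linear // z_coord_hyperbolic subrr. Qed.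

Lemma hyperbolic0 : hyperbolic 0 0 = 0.
Proof.
by rewrite /hyperbolic !big1 ?addr0 // => i _; rewrite mxE scale0r.
Qed.

Lemma residueK x : residue (residue x) = residue x.
Proof.
by rewrite {1}/residue v_coord_residue z_coord_residue hyperbolic0 subr0.
Qed.

Definition complement : {vspace g} := limg (linfun residue).

Lemma mem_complement x : residue x \in complement.
Proof. by rewrite -(lfunE residue) memv_img ?memvf. Qed.

Lemma complementP x : x \in complement ->
  [/\ residue x = x, v_coord x = 0 & z_coord x = 0].
Proof.
case/memv_imgP => y _ ->; rewrite lfunE /=.
by rewrite residueK v_coord_residue z_coord_residue.
Qed.

Lemma form_split x y : phi x y
  = \sum_i (v_coord x 0 i * z_coord y 0 i + z_coord x 0 i * v_coord y 0 i)
    + phi (residue x) (residue y).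
Proof.
rewrite -form_hyperbolic [phi (residue x) _]linearBl /=.
rewrite [phi (hyperbolic _ _) (residue y)]quad_form_sym.
rewrite [phi (residue y) _]form_hyperbolic v_coord_residue z_coord_residue.
rewrite [X in _ - X]big1 ?subr0 => [|i _]; last first.
  by rewrite !mxE !mul0r addr0.
by rewrite -linearDr addrC subrK.
Qed.

Definition complement_form (x y : subvs_of complement) : K :=
  phi (vsval x) (vsval y).

Fact complement_form_bilinear : bilinear_for
  (GRing.Scale.Law.clone _ _ *%R _) (GRing.Scale.Law.clone _ _ *%R _)
  complement_form.
Proof.
by split=> [u'|u] k x y; rewrite /complement_form linearP ?linearPl ?linearPr.
Qed.

HB.instance Definition _ := bilinear_isBilinear.Build K (subvs_of complement)
  (subvs_of complement) K _ _ complement_form complement_form_bilinear.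

Fact complement_form_sym x y : complement_form x y = complement_form y x.
Proof. exact: quad_form_sym. Qed.

(** An element of the complement pairs with any y of g as it does with the residue of y, so
    nondegeneracy descends from g. *)
Fact complement_form_nondeg x : (forall y, complement_form x y = 0) -> x = 0.
Proof.
move=> x0; apply: val_inj => /=; apply: (quad_form_nondeg (q := g)) => y.
have [rx vx zx] := complementP (subvsP x).
rewrite form_split vx zx big1 ?add0r => [|i _].
  by rewrite rx -(vsprojK (mem_complement y)); apply: x0.
by rewrite !mxE !mul0r addr0.
Qed.

Definition complement_quad : quadraticLie K :=
  abelian_quad complement_form_sym complement_form_nondeg.

(** Removing from w its v-part leaves a vector orthogonal to all z_i, hence central. A bracket
    therefore depends only on the v-parts of its arguments. *)
Lemma bracket_v_coord x y :
  [lie x, y] = \sum_i \sum_j (v_coord x 0 i * v_coord y 0 j) *: [lie v i, v j].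
Proof.
have vE u w : [lie u, w] = [lie u, hyperbolic (v_coord w) 0].
  apply/eqP; rewrite -subr_eq0 -linearBr; apply/eqP/orthogonal_central => i.
  have /rowP/(_ i) : v_coord (w - hyperbolic (v_coord w) 0) = 0.
    by rewrite subr_linear // v_coord_hyperbolic subrr.
  by rewrite !mxE.
have h0 u : hyperbolic u 0 = \sum_i u 0 i *: v i.
  rewrite /hyperbolic [X in _ + X]big1 ?addr0 // => i _.
  by rewrite mxE scale0r.
rewrite vE lie_skew vE -lie_skew !h0 linear_sumlz; apply: eq_bigr => i _.
rewrite linearZl_LR linear_sumr scaler_sumr; apply: eq_bigr => j _ /=.
by rewrite linearZr_LR /= scalerA.
Qed.

Definition structure_tensor i j k : K := phi [lie v i, v j] (v k).

Lemma structure_tensor_alternating : alternating structure_tensor.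
Proof.
split=> [i j k|i j k|i k]; rewrite /structure_tensor.
- by rewrite lie_skew linearNl.
- have /eqP := quad_form_inv (v i) (v j) (v k); rewrite addr_eq0 => /eqP->.
  by rewrite quad_form_sym.
- by rewrite lie_bracket_alt linear0l.
Qed.

(** If w is in the kernel, then the sum of the w_k v_k is orthogonal to all brackets, hence to g^2.
    Its pairings with the z_i, which are the w_i, vanish. *)
Lemma structure_tensor_nondegenerate : tensor_nondegenerate structure_tensor.
Proof.
move=> w w0; rewrite -(v_coord_hyperbolic w 0); apply/rowP => i.
rewrite [LHS]mxE [RHS]mxE quad_form_sym; apply: orthogonal_lie_sq; last first.
  exact: vbasis_mem (memt_nth _ _ (ltn_ord _)).
move=> x y; rewrite bracket_v_coord linear_sumlz big1 // => j _.
rewrite linear_sumlz big1 // => k _; rewrite linearZl_LR /= form_hyperbolic.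
rewrite -[RHS](mulr0 (v_coord x 0 j * v_coord y 0 k)); congr (_ * _).
rewrite -[RHS](w0 j k); apply: eq_bigr => l _.
by rewrite [X in _ * X + _]mxE mulr0 add0r mxE mulrC.
Qed.

(** Isotropy of g^2 kills the v-coordinates, and g^2 is spanned by the z_i, which lie in the
    hyperbolic space. *)
Lemma lie_sq_residue x : x \in lie_sq g ->
  (v_coord x = 0) * (residue x = 0).
Proof.
move=> sq_x; have vx0 : v_coord x = 0.
  apply/rowP => i; rewrite !mxE lie_sq_isotropic //.
  exact: vbasis_mem (memt_nth _ _ (ltn_ord _)).
split=> //; rewrite /residue vx0.
have xE : x = hyperbolic 0 (\row_i coord z i x).
  rewrite /hyperbolic big1 ?add0r => [|i _]; last by rewrite mxE scale0r.
  by rewrite {1}(coord_vbasis sq_x); apply: eq_bigr => i _; rewrite mxE.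
by rewrite [in z_coord x]xE z_coord_hyperbolic -xE subrr.
Qed.

(** * The isometric isomorphism onto n(A) + a *)

Hypothesis T_quad : quadratic_family (tensor_family structure_tensor).
Local Notation h := (orthogonal_sum (attached_quad T_quad) complement_quad).

Definition decomposition (x : g) : h :=
  (v_coord x, z_coord x, vsproj complement (residue x)).

Fact decomposition_linear : linear decomposition.
Proof.
move=> k x y; rewrite /decomposition v_coord_linear z_coord_linear.
by rewrite residue_linear linearP.
Qed.

HB.instance Definition _ := GRing.isLinear.Build K g h _ decomposition
  decomposition_linear.

Lemma decomposition_bij : bijective decomposition.
Proof.
exists (fun y : h => hyperbolic y.1.1 y.1.2 + vsval y.2) => [x|[[p q] u]] /=.
  by rewrite vsprojK ?mem_complement // addrC subrK.
have [ru vu zu] := complementP (subvsP u).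
rewrite /decomposition.
have -> : v_coord (hyperbolic p q + vsval u) = p.
  rewrite -[hyperbolic p q]scale1r v_coord_linear vu scale1r addr0.
  exact: v_coord_hyperbolic.
have -> : z_coord (hyperbolic p q + vsval u) = q.
  rewrite -[hyperbolic p q]scale1r z_coord_linear zu scale1r addr0.
  exact: z_coord_hyperbolic.
have -> : residue (hyperbolic p q + vsval u) = vsval u.
  rewrite linearD /= ru {1}/residue v_coord_hyperbolic z_coord_hyperbolic.
  by rewrite subrr add0r.
by rewrite vsvalK.
Qed.

Lemma isometric_decomposition : isometrically_isomorphic g h.
Proof.
exists decomposition; split; first exact: decomposition_bij.
  move=> x y; have [v0 r0] := lie_sq_residue (mem_lie_sq x y).
  rewrite /= /decomposition v0 r0 linear0; congr (_, _, _).
  (* The z_k-coordinate of [x, y] is its pairing with v_k, which expands into entries of the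
     structure tensor. *)
  apply/rowP => k; rewrite mxE bracket_v_coord linear_sumlz summxE.
  apply: eq_bigr => i _; rewrite linear_sumlz summxE; apply: eq_bigr => j _.
  by rewrite linearZl_LR !mxE.
move=> x y; rewrite form_split; congr (_ + _).
by rewrite /= /complement_form /= !vsprojK ?mem_complement.
Qed.

End Decomposition.

(** * Existence in every type and classification *)

Theorem theorem14 (K : fieldType) (charK : [pchar K] =i pred0)
    (d : nat) (hd : (3 <= d)%N) :
  (exists g : quadraticLie K, two_step_nilpotent g /\ lie_type g = d) /\
  (forall g : quadraticLie K,
     (two_step_nilpotent g /\ lie_type g = d) <->
     (exists (d1 d2 : nat) (A : 'I_d1 -> 'M[K]_d1)
             (Aquad : quadratic_family A) (a : quadraticLie K),
        [/\ d = (d1 + d2)%N, (3 <= d1)%N /\ d1 <> 4%N,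
            abelian_lie a, \dim {:a} = d2
          & isometrically_isomorphic g
              (orthogonal_sum (attached_quad Aquad) a)])).
Proof.
have two_n0 : 2%:R != 0 :> K by move/pcharf0P: charK => ->.
split.
  (* The cross product gives type 3, and an abelian summand supplies the remaining d - 3. *)
  have [T altT ndT] := cross_product_tensor K.
  exists (orthogonal_sum (attached_quad (tensor_quadratic_family altT ndT isT))
            (dot_quad K (d - 3))).
  split; first exact: attached_sum_two_step.
  by rewrite attached_sum_type // dim_dot_quad subnKC.
move=> g; split=> [[g2 g_type]|]; last first.
  case=> [d1 [d2 [A [Aquad [a [-> _ a0 <- [f [f_bij f_lie _]]]]]]]].
  split; first exact: lie_iso_two_step f_lie f_bij (attached_sum_two_step _ a0).
  by rewrite (lie_iso_type f_lie f_bij) attached_sum_type.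
have [v [v_z v_v]] := isotropic_dual_family (@quad_form_sym _ g)
  (@quad_form_nondeg _ g) two_n0 (basis_free (vbasisP (lie_sq g)))
  (fun i j => lie_sq_isotropic g2 (vbasis_mem (memt_nth _ _ (ltn_ord i)))
                (vbasis_mem (memt_nth _ _ (ltn_ord j)))).
have altT := structure_tensor_alternating v.
have ndT := structure_tensor_nondegenerate g2 v_z.
have [m3 m4] : (3 <= \dim (lie_sq g))%N /\ \dim (lie_sq g) <> 4%N.
  apply: alternating_dim altT ndT _; rewrite lt0n dimv_eq0.
  by apply/eqP; case: g2.
pose Tquad := tensor_quadratic_family altT ndT (ltnW m3).
have iso := isometric_decomposition g2 v_z v_v Tquad.
(* Here d1 is the dimension of g^2. The equality d = d1 + d2 is obtained by transporting the type
   along the isomorphism. *)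
exists (\dim (lie_sq g)), (\dim {:complement_quad g2 v_z v_v}), _, Tquad.
exists (complement_quad g2 v_z v_v); split=> //.
case: iso => f [f_bij f_lie _].
by rewrite -g_type (lie_iso_type f_lie f_bij) attached_sum_type.
Qed.
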